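(* Suppose $B_\kappa$ is a $\kappa$-sized totally imperfect separable metrizable space. Then $[\omega_1,\kappa]^r\cup\mathrm{spec}(\omega^\omega)\subseteq\mathrm{spec}(\mathcal{K}(B_\kappa))$. If $\kappa=\aleph_n$ for some $n\in\omega$, then $[\omega_1,\kappa]^r\cup\mathrm{spec}(\omega^\omega)=\mathrm{spec}(\mathcal{K}(B_\kappa))$. In particular, $\mathrm{spec}(\mathcal{K}(\mathbb{Q}))=\{\omega_1\}\cup\mathrm{spec}(\omega^\omega)$.
   Context: A directed set is a partially ordered set in which every finite subset has an upper bound. For directed sets $P,Q$, write $P\ge_T Q$ if there is a map $\phi:P\to Q$ carrying every cofinal subset of $P$ to a cofinal subset of $Q$. The spectrum of a directed set $P$ is $\mathrm{spec}(P)=\{\kappa\ge\omega:\kappa\text{ is a regular cardinal and }P\ge_T\kappa\}$; equivalently, it is the set of all infinite regular $\kappa$ such that $P$ does not have calibre $\kappa$, where $P$ has calibre $\kappa$ if every $\kappa$-sized subset of $P$ contains a $\kappa$-sized subset all of whose $\kappa$-sized subsets are bounded above. For cardinals $\lambda,\mu$, $[\lambda,\mu]^r$ denotes $\{\theta:\theta\text{ is regular and }\lambda\le\theta\le\mu\}$. The set $\omega^\omega$ has the coordinatewise order. For a space $X$, $\mathcal{K}(X)$ is the set of compact subsets of $X$ ordered by inclusion. A separable metrizable space is totally imperfect if it contains no Cantor set (equivalently, every compact subset of it is countable). $\mathbb{Q}$ is the space of rationals.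
   Formalization: The cardinal κ is assumed uncountable (κ ≥ ω_1) in the first two claims; they fail for κ = ω, e.g. for the discrete space ω, where spec(K(ω)) = {ω} omits the uncountable members of spec(ω^ω). The claim about Q is unaffected. *)

(* Defs.v *)
From HB Require Import structures.
From mathcomp Require Import all_boot all_order all_algebra.
From mathcomp Require Import all_classical all_reals all_analysis.
From mathcomp Require Import wochoice.

Set Implicit Arguments.
Unset Strict Implicit.
Unset Printing Implicit Defensive.

Import Order.TTheory.
Import numFieldNormedType.Exports.

Local Open Scope classical_set_scope.
Local Open Scope card_scope.
Local Open Scope order_scope.

HB.mixin Record isDirected d T of Order.POrder d T := {
  finite_has_ubound : forall A : set T, finite_set A -> has_ubound A
}.

#[short(type="directedType")]
HB.structure Definition Directed d :=
  { T of isDirected d T & Order.POrder d T }.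

Definition cofinal d (P : porderType d) (A : set P) : Prop :=
  forall x, exists2 y, A y & x <= y.

(* The target is any poset, since the cardinal 0 below is not directed. *)
Definition tukey_ge d d' (P : directedType d) (Q : porderType d') : Prop :=
  exists phi : P -> Q, forall A : set P, cofinal A -> cofinal (phi @` A).

(* A cardinal is an initial ordinal, up to order isomorphism: a well-order none
   of whose proper initial segments has the cardinality of the whole. Two
   cardinals are therefore equal exactly when their carriers are equipotent,
   and equality of cardinals is always meant as [cardinal_eq]. *)
Record cardinal := Cardinal {
  card_disp : Order.disp_t ;
  card_sort :> orderType card_disp ;
  card_well_order : well_order (<=%O : rel card_sort) ;
  card_initial : forall x : card_sort, ~ ([set: card_sort] #<= [set y | y < x])
}.

Definition cardinal_le (k l : cardinal) : Prop := [set: k] #<= [set: l].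
Definition cardinal_lt (k l : cardinal) : Prop :=
  cardinal_le k l /\ ~ cardinal_le l k.
Definition cardinal_eq (k l : cardinal) : Prop := [set: k] #= [set: l].

Definition is_succ_cardinal (k l : cardinal) : Prop :=
  cardinal_lt k l /\ forall m, cardinal_lt k m -> cardinal_le l m.

Lemma inj_card_leT (T U : Type) (B : set U) (f : T -> U) :
  injective f -> (forall x, B (f x)) -> [set: T] #<= B.
Proof.
move=> fI fB; rewrite -(card_le_eql (inj_card_eq (in2W fI))).
by apply: subset_card_le => _ [x _ <-]; exact: fB.
Qed.

Lemma card_leT_inj (T U : Type) (B : set U) : [set: T] #<= B ->
  exists2 f : T -> U, injective f & forall x, B (f x).
Proof.
move=> /card_leP[f].
exists (fun t => set_val (f (exist _ t (mem_set I)))).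
  move=> x y /val_inj fxy.
  by have /(congr1 val) := 'inj_f (mem_set I) (mem_set I) fxy.
by move=> x; exact: set_valP.
Qed.

Section well_ordered.
Variables (T : choiceType) (R : rel T) (Rwo : well_order R).

Definition wo_sort of well_order R : Type := T.
Local Notation W := (wo_sort Rwo).
HB.instance Definition _ := Choice.on W.

Let Rchain : wo_chain R predT. Proof. exact: withinW. Qed.

Let Rrefl : reflexive R.
Proof. by move=> x; exact: (wo_chain_reflexive Rchain). Qed.

Let Ranti : antisymmetric R.
Proof. by move=> x y; exact: (wo_chain_antisymmetric Rchain). Qed.

Let Rtot : total R.
Proof. by move=> x y; exact: (wo_chainW Rchain). Qed.

Let Rtrans : transitive R.
Proof.
move=> y x z Rxy Ryz.
have [|m [[]]] := @Rwo (mem [:: x; y; z]); first by exists x; rewrite inE eqxx.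
rewrite !inE => /or3P[] /eqP-> lb _; first by apply: lb; rewrite !inE eqxx !orbT.
- have /Ranti -> // : R x y && R y x.
  by rewrite Rxy lb// !inE eqxx.
- have /Ranti <- // : R y z && R z y.
  by rewrite Ryz lb// !inE eqxx orbT.
Qed.

HB.instance Definition _ :=
  Order.Le_isPOrder.Build Order.default_display W Rrefl Ranti Rtrans.
HB.instance Definition _ :=
  Order.POrder_isTotal.Build Order.default_display W Rtot.

Lemma wo_sort_leE (x y : W) : (x <= y) = R x y. Proof. by []. Qed.

End well_ordered.

Lemma well_order_min d (T : orderType d) (A : set T) :
  well_order (<=%O : rel T) -> A !=set0 ->
  exists2 x, A x & forall y, A y -> x <= y.
Proof.
move=> wo [a Aa].
have [|x [[xA lb] _]] := @wo (mem A); first by exists a; exact: mem_set.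
by exists x => [|y Ay]; [exact: set_mem|exact: lb (mem_set Ay)].
Qed.

Lemma well_order_comparable d d' (T : orderType d) (U : orderType d') :
  well_order (<=%O : rel T) -> well_order (<=%O : rel U) ->
  (exists2 f : T -> U, injective f & forall x y, y <= f x -> exists z, f z = y)
  \/ (exists2 f : U -> T, injective f &
        forall x y, y <= f x -> exists z, f z = y).
Proof.
move=> Two Uwo.
pose P (G : set (T * U)) :=
  [/\ forall p q, G p -> G q -> (p.1 <= q.1) = (p.2 <= q.2),
      forall p t, G p -> t <= p.1 -> exists u, G (t, u) &
      forall p u, G p -> u <= p.2 -> exists t, G (t, u)].
have [F FP Ftot|G [[Gle Gdom Gcod] maxG]] := @Zorn_bigcup _ P.
  split=> [p q [A FA Ap] [B FB Bq]|p t [A FA Ap] tp|p u [A FA Ap] up].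
  - have [AB|BA] := Ftot _ _ FA FB.
      by have [+ _ _] := FP _ FB; apply => //; exact: AB.
    by have [+ _ _] := FP _ FA; apply => //; exact: BA.
  - by have [_ /(_ _ _ Ap tp)[u Au] _] := FP _ FA; exists u, A.
  - by have [_ _ /(_ _ _ Ap up)[t At]] := FP _ FA; exists t, A.
have G1 t u u' : G (t, u) -> G (t, u') -> u = u'.
  move=> Gu Gu'; apply/le_anti.
  by rewrite -(Gle _ _ Gu Gu') -(Gle _ _ Gu' Gu) /= lexx.
have G2 t t' u : G (t, u) -> G (t', u) -> t = t'.
  move=> Gt Gt'; apply/le_anti.
  by have /= -> := Gle _ _ Gt Gt'; have /= -> := Gle _ _ Gt' Gt; rewrite lexx.
have [totG|] := pselect (forall t, exists u, G (t, u)).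
  left; have [f Gf] := choice totG; exists f => [x y fxy|x y].
    by apply: (G2 _ _ (f x) (Gf x)); rewrite fxy.
  by move=> /(Gcod _ _ (Gf x))[z Gz]; exists z; exact: (G1 _ _ _ (Gf z) Gz).
move=> /existsNP nT.
have [surG|] := pselect (forall u, exists t, G (t, u)).
  right; have [f Gf] := choice surG; exists f => [x y fxy|x y].
    by apply: (G1 (f x) _ _ (Gf x)); rewrite fxy.
  by move=> /(Gdom _ _ (Gf x))[z Gz]; exists z; exact: (G2 _ _ _ (Gf z) Gz).
move=> /existsNP nU; exfalso.
have [t nGt tmin] := well_order_min Two nT.
have [u nGu umin] := well_order_min Uwo nU.
have Glt p : G p -> p.1 < t /\ p.2 < u.
  move=> Gp; split; rewrite ltNge; apply/negP.
    by move=> /(Gdom _ _ Gp).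
  by move=> /(Gcod _ _ Gp).
apply: (maxG ((t, u) |` G)).
  split=> [|/(_ (t, u)) tu]; first by right.
  by apply: nGt; exists u; apply: tu; left.
split.
- move=> p q [->|Gp] [->|Gq] /=; rewrite ?lexx//.
  + by have [] := Glt _ Gq; rewrite !leNgt => -> ->.
  + by have [/ltW -> /ltW ->] := Glt _ Gp.
  + exact: Gle.
- move=> p x pG xp; have [->|xt] := eqVneq x t; first by exists u; left.
  have : x < t.
    by rewrite lt_neqAle xt (le_trans xp)//; case: pG => [->//|/Glt[/ltW]].
  by rewrite ltNge => /negP h; apply: contrapT => nx; apply/h/tmin => -[v Gv];
     apply: nx; exists v; right.
- move=> p x pG xp; have [->|xu] := eqVneq x u; first by exists t; left.
  have : x < u.
    by rewrite lt_neqAle xu (le_trans xp)//; case: pG => [->//|/Glt[_ /ltW]].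
  by rewrite ltNge => /negP h; apply: contrapT => nx; apply/h/umin => -[v Gv];
     apply: nx; exists v; right.
Qed.

Lemma well_order_sub (T : choiceType) (R : rel T) (D : set T) :
  well_order R -> well_order (fun x y : D => R (val x) (val y)).
Proof.
move=> Rwo.
have Rchain : wo_chain R predT by exact: withinW.
apply: antisymmetric_well_order => [x y|A [a Aa]].
  by move=> /(wo_chain_antisymmetric Rchain isT isT)/val_inj.
have [|x [[/asboolP[z Az zx] lb] _]] := @Rwo [pred x | `[< exists2 z : D, z \in A & val z = x >]].
  by exists (val a); apply/asboolP; exists a.
exists z; split=> // y Ay.
by rewrite zx; apply: lb; apply/asboolP; exists y.
Qed.

Lemma succ_cardinal_exists (k : cardinal) : exists l, is_succ_cardinal k l.
Proof.
have [R Rwo] := well_ordering_principle (set k).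
pose W : orderType _ := wo_sort Rwo.
have Wwo : well_order (<=%O : rel W) by [].
pose D : set W := [set x | [set y | y < x] #<= [set: k]].
have nDk : ~ (D #<= [set: k]).
  have [DT|/existsNP[x Dx]] := pselect (forall x, D x).
    have -> : D = [set: set k] by apply/seteqP; split.
    move=> /card_leT_inj[f fI _].
    pose E : set k := [set x | exists2 A, f A = x & ~ A x].
    have [EfE|nEfE] := pselect (E (f E)).
      by have [A /fI AE] := EfE; rewrite AE.
    by apply: (nEfE); exists E.
  have [|m nDm lem] := @well_order_min _ _ (~` D) Wwo; first by exists x.
  suff -> : D = [set y | y < m] by [].
  apply/seteqP; split => y /=; last first.
    by move=> ym; apply: contrapT => /lem; rewrite leNgt ym.
  rewrite ltNge => Dy; apply/negP => my; apply: nDm.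
  apply: card_le_trans Dy; apply: subset_card_le => z /= zm.
  exact: lt_le_trans my.
have Swo := well_order_sub (D := D) Wwo.
pose S : orderType _ := wo_sort Swo.
have SSwo : well_order (<=%O : rel S) by [].
have SD : [set: S] #= D by exact: card_setT.
have Sinit (x : S) : [set y | y < x] #<= [set: k].
  apply: card_le_trans (set_mem (valP (x : D)) : D (val (x : D))).
  rewrite -(card_le_eql (inj_card_eq (in2W (@val_inj _ _ D)))).
  apply: subset_card_le => _ [y yx <-] /=.
  move: (yx : (y : S) < x); rewrite !lt_neqAle => /andP[nyx ?].
  by apply/andP; split => //; apply: contra nyx => /eqP/val_inj ->.
have Sini (x : S) : ~ ([set: S] #<= [set y | y < x]).
  rewrite (card_le_eql SD) => h; apply: nDk.
  exact: card_le_trans (Sinit x).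
exists (Cardinal SSwo Sini); split.
  split; rewrite /cardinal_le /=; last by rewrite (card_le_eql SD).
  have [[f fI _]|[f fI _]] := well_order_comparable (@card_well_order k) SSwo.
    exact: (@inj_card_leT _ _ _ f).
  by exfalso; apply: nDk; rewrite -(card_le_eql SD); exact: (@inj_card_leT _ _ _ f).
move=> m [_ nmk]; rewrite /cardinal_le /=.
have [[f fI _]|[f fI fS]] := well_order_comparable SSwo (@card_well_order m).
  exact: (@inj_card_leT _ _ _ f).
have [fsurj|/existsNP[x nx]] := pselect (forall x, exists z, f z = x).
  have [g fg] := choice fsurj.
  by apply: (@inj_card_leT _ _ _ g) => // x y; rewrite -{2}(fg x) -{2}(fg y) => ->.
exfalso; apply: nmk; rewrite /cardinal_le; apply: card_le_trans (Sinit x).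
apply: (@inj_card_leT _ _ _ f) => // z /=.
by rewrite ltNge; apply/negP => /fS.
Qed.

Definition succ_cardinal (k : cardinal) : cardinal :=
  projT1 (cid (succ_cardinal_exists k)).

Lemma succ_cardinalP (k : cardinal) : is_succ_cardinal k (succ_cardinal k).
Proof. exact: projT2 (cid (succ_cardinal_exists k)). Qed.

Lemma nat_well_order : well_order (<=%O : rel nat).
Proof.
apply: antisymmetric_well_order => [|A [n An]]; first exact: le_anti.
have exA : exists n, n \in A by exists n.
by exists (ex_minn exA); case: ex_minnP => m Am lb; split=> // x /lb.
Qed.

Lemma nat_initial (n : nat) : ~ ([set: nat] #<= [set m | (m < n)%O]).
Proof.
move=> /card_le_finite nfin.
by apply: infinite_nat; apply: nfin; exact: (finite_II n).
Qed.

Definition aleph0 : cardinal := Cardinal nat_well_order nat_initial.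

Fixpoint aleph (n : nat) : cardinal :=
  if n is n'.+1 then succ_cardinal (aleph n') else aleph0.

Definition regular (k : cardinal) : Prop :=
  infinite_set [set: k] /\ forall A : set k, cofinal A -> [set: k] #<= A.

(* Sets of cardinals are predicates: [cardinal] is too large for [set]. *)
Definition regular_interval (l m k : cardinal) : Prop :=
  [/\ regular k, cardinal_le l k & cardinal_le k m].

Definition spec d (P : directedType d) (k : cardinal) : Prop :=
  regular k /\ tukey_ge P k.

Lemma binary_has_ubound d (P : porderType d) (x0 : P) :
  (forall x y : P, exists2 z, x <= z & y <= z) ->
  forall A : set P, finite_set A -> has_ubound A.
Proof.
move=> binP A /finite_seqP[s ->]; elim: s => [|a s [u us]].
  by exists x0.
have [v av uv] := binP a u; exists v => x /=.
by rewrite inE => /predU1P[->//|xs]; exact: le_trans (us _ xs) uv.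
Qed.

Lemma natfun_has_ubound (A : set (nat -> nat)) :
  finite_set A -> has_ubound A.
Proof.
apply: binary_has_ubound; first exact: (fun=> 0).
by move=> f g; exists (fun n => maxn (f n) (g n)); apply/asboolP => n;
  rewrite leEnat ?leq_maxl ?leq_maxr.
Qed.

HB.instance Definition _ := isDirected.Build _ (nat -> nat) natfun_has_ubound.

Definition compact_sets (X : topologicalType) : Type :=
  {A : set X | `[< compact A >]}.

Section compact_sets.
Variable X : topologicalType.

HB.instance Definition _ := [isSub for @sval _ _ : compact_sets X -> set X].
HB.instance Definition _ := [Choice of compact_sets X by <:].
HB.instance Definition _ := 
  [SubChoice_isSubPOrder of compact_sets X by <: with set_display].

Lemma compact_sets_leP (A B : compact_sets X) :
  reflect (val A `<=` val B) (A <= B).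
Proof. exact: asboolP. Qed.

Lemma compact_sets_has_ubound (A : set (compact_sets X)) :
  finite_set A -> has_ubound A.
Proof.
apply: binary_has_ubound; first by exists set0; apply/asboolP/compact0.
move=> K L; have cKL : `[< compact (val K `|` val L) >].
  apply/asboolP; apply: compactU.
  - exact: asboolW (valP K).
  - exact: asboolW (valP L).
exists (exist (fun A : set X => `[< compact A >]) _ cKL : compact_sets X).
  by apply/compact_sets_leP; exact: classical_sets.subsetUl.
by apply/compact_sets_leP; exact: classical_sets.subsetUr.
Qed.

HB.instance Definition _ :=
  isDirected.Build _ (compact_sets X) compact_sets_has_ubound.

End compact_sets.

Definition homeomorphic (X Y : topologicalType) : Prop :=
  exists (f : X -> Y) (g : Y -> X),
    [/\ continuous f, continuous g, cancel f g & cancel g f].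

Definition metrizable (R : realType) (X : topologicalType) : Prop :=
  exists M : metricType R, homeomorphic X M.

Definition separable (X : topologicalType) : Prop :=
  exists2 D : set X, countable D & dense D.

(* [A] is coerced to the corresponding subtype, with the subspace topology. *)
Definition totally_imperfect (X : topologicalType) : Prop :=
  forall A : set X, ~ homeomorphic cantor_space A.

(* [rat] with the topology inherited from the real line *)
Definition rationals (R : realType) : topologicalType :=
  initial_topology (ratr : rat -> R).

(* Main.v *)
(** Total imperfectness makes every compact [K] in [B] countable, so an injection
[theta -> B] is a Tukey map [t |-> {b t}] for regular [theta] between [omega_1]
and [kappa].  Since [B] is uncountable it has a point [p] without compact
neighbourhood; each small ball around [p] has an increasing open cover with no
finite subcover, and [K] is sent to the sequence of the first indices at which
[K] is covered.  A sequence converging to [p] that escapes prescribed members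
of the covers witnesses [K(B) >=_T omega^omega].

For the upper bound let [theta > kappa = aleph_n].  Pigeonholing along the
initial segments of [aleph_n], ..., [aleph_1] yields one countable
[C = {q_0, q_1, ...}] for which cofinally many indices are sent into [K(C)].
Split the complement of [q_i] into annuli [A i j] shrinking to [q_i].  For
compact [K] in [C] the tree of nonempty intersections of [K] with
[A 0 j_0], [A 1 j_1], ... is well-founded, because a branch would give a point
of [K] different from all [q_i]; it thus has a rank below [omega_1].  By
induction on the rank bound [w], the sets of rank at most [w] are covered by a
monotone map [omega^omega -> K(B)]: a countable product or a countable union of
such families is again of this kind.  As [theta > omega_1], one [w] suffices.
In [Q] all countable ranks occur, which gives [K(Q) >=_T omega_1]. *)

Require Import Defs.
From mathcomp Require Import all_boot all_order all_algebra.
From mathcomp Require Import all_classical all_reals all_analysis.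
From mathcomp Require Import wochoice lra.

Set Implicit Arguments.
Unset Strict Implicit.
Unset Printing Implicit Defensive.

Import Order.TTheory GRing.Theory Num.Theory.
Import numFieldNormedType.Exports.

Local Open Scope order_scope.
Local Open Scope card_scope.
Local Open Scope classical_set_scope.

(** * Cardinals *)

Lemma card_le_set_typeP (T U : Type) (A : set T) (B : set U) :
  ([set: A] #<= B) = (A #<= B).
Proof. by rewrite (card_le_eql (card_setT A)). Qed.

(** Well-order [S]. If some initial segment is as large as the whole, cut at the least [x] for which
    this happens: the order below [x] is then initial. *)
Lemma cardinal_of_set (T : Type) (S : set T) :
  exists m : cardinal, S #= [set: m].
Proof.
pose U : Type := S.
pose U' := {classic U}.
have [r rwo] := well_ordering_principle U'.
pose W : orderType _ := wo_sort rwo.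
have Wwo : well_order (<=%O : rel W) by [].
have SW : S #= [set: W] by exact: card_setT_sym.
have [ini|/existsNP[x0 /contrapT Wx0]] :=
    pselect (forall x : W, ~ ([set: W] #<= [set y | y < x])).
  by exists (Cardinal Wwo ini).
pose D : set W := [set x | [set: W] #<= [set y | y < x]].
have [|x Wx xmin] := @well_order_min _ _ D Wwo; first by exists x0.
pose E : set W := [set y | y < x].
have Ewo := well_order_sub (D := E) Wwo.
pose V : orderType _ := wo_sort Ewo.
have VE : [set: V] #= E by exact: card_setT.
have WE : [set: W] #= E.
  by rewrite card_eq_le Wx subset_card_le.
have Vini (v : V) : ~ ([set: V] #<= [set y | y < v]).
  move=> Vv; have vx : val (v : E) < x by exact: (set_mem (valP (v : E))).
  suff /xmin : D (val (v : E)) by rewrite leNgt vx.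
  rewrite /D /= (card_le_eql WE) -(card_le_eql VE).
  apply: card_le_trans Vv _.
  rewrite -(card_le_eql (inj_card_eq (in2W (@val_inj _ _ E)))).
  apply: subset_card_le => _ [y yv <-] /=.
  move: (yv : (y : V) < v); rewrite !lt_neqAle => /andP[nyv ?].
  by apply/andP; split => //; apply: contra nyv => /eqP/val_inj ->.
exists (@Cardinal _ V Ewo Vini); apply: (card_eq_trans SW).
by apply: (card_eq_trans WE); rewrite card_eq_sym.
Qed.

Lemma cardinal_le_total (k l : cardinal) : cardinal_le k l \/ cardinal_le l k.
Proof.
have [[f fI _]|[f fI _]] := well_order_comparable (@card_well_order k)
  (@card_well_order l).
- by left; exact: (@inj_card_leT _ _ _ f).
- by right; exact: (@inj_card_leT _ _ _ f).
Qed.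

Lemma card_le_succ_cardinal (k : cardinal) (T : Type) (S : set T) :
  S #<= [set: k] \/ [set: succ_cardinal k] #<= S.
Proof.
have [m Sm] := cardinal_of_set S.
have [Sk|Sk] := pselect (S #<= [set: k]); [by left|right].
rewrite (card_le_eqr Sm); apply: (succ_cardinalP k).2.
have nmk : ~ cardinal_le m k by rewrite /cardinal_le -(card_le_eql Sm).
by split => //; case: (cardinal_le_total k m).
Qed.

Lemma cardinal_le_succ (k : cardinal) : cardinal_le k (succ_cardinal k).
Proof. by have [[]] := succ_cardinalP k. Qed.

Lemma succ_cardinal_initial (k : cardinal) (x : succ_cardinal k) :
  [set y | y < x] #<= [set: k].
Proof.
have [//|h] := card_le_succ_cardinal k [set y | y < x].
by have := @card_initial _ x.
Qed.

Lemma cardinal_lt_ind (k : cardinal) (P : k -> Prop) :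
  (forall x, (forall y, y < x -> P y) -> P x) -> forall x, P x.
Proof.
move=> IH x; apply: contrapT => nPx.
have [|m nPm lem] := @well_order_min _ _ (~` P) (@card_well_order k).
  by exists x.
by apply/nPm/IH => y ym; apply: contrapT => /lem; rewrite leNgt ym.
Qed.


(** Below a maximum [x] there would still be an injective sequence [g]. Shifting along [g] makes
    room for [x], so the whole order would inject into the segment below [x], against
    [card_initial]. *)
Lemma infinite_cardinal_no_max (k : cardinal) : infinite_set [set: k] ->
  forall x : k, exists y, x < y.
Proof.
move=> kinf x; apply: contrapT => /forallNP nx.
have lex y : y <= x by rewrite leNgt; apply/negP/nx.
have /infiniteP/card_leT_inj[g gI gx] : infinite_set [set y : k | y < x].
  apply: (sub_infinite_set _ (infinite_setD kinf (finite_set1 x))).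
  move=> y [_ /= yx].
  by rewrite lt_neqAle lex andbT; apply/eqP.
pose h y := if pselect (exists n, g n = y) is left e then g (projT1 (cid e)).+1
            else if y == x then g 0 else y.
have hP y : [\/ exists2 n, g n = y & h y = g n.+1, y = x /\ h y = g 0 |
                (forall n, g n <> y) /\ y < x /\ h y = y].
  rewrite /h; case: pselect => [e|ne].
    by constructor 1; case: (cid e) => n gn /=; exists n.
  have [yx|yx] := eqVneq y x; first by constructor 2.
  constructor 3; split; first by move=> n gn; apply: ne; exists n.
  by rewrite lt_neqAle yx lex.
apply: (@card_initial _ x); apply: (@inj_card_leT _ _ _ h) => [y z|y].
  have [[n <- ->]|[-> ->]|[ny [_ ->]]] := hP y;
  have [[m <- ->]|[-> ->]|[nz [_ ->]]] := hP z => //.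
  - by move=> /gI[->].
  - by move=> /gI.
  - by move=> /nz.
  - by move=> /gI.
  - by move=> /nz.
  - by move=> /esym/ny.
  - by move=> /esym/ny.
by have [[n _ ->]|[_ ->]|[_ [yx ->]]] := hP y; [exact: gx|exact: gx|].
Qed.

(* Every element of an infinite initial ordinal is a limit plus an integer,
   and the integer part has room for a pair of integers. *)
Lemma card_le_mul_nat (k : cardinal) : infinite_set [set: k] ->
  [set: k * nat] #<= [set: k].
Proof.
move=> kinf.
have kwo := @card_well_order k.
have /choice[s sP] (x : k) : exists y, x < y /\ forall z, x < z -> y <= z.
  have [|y xy ymin] := @well_order_min _ _ [set y | x < y] kwo.
    exact: infinite_cardinal_no_max.
  by exists y.
have sI : injective s.
  move=> x y sxy; apply/eqP; case: ltgtP => // xy.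
    by have := (sP x).2 _ xy; rewrite sxy leNgt (sP y).1.
  by have := (sP y).2 _ xy; rewrite -sxy leNgt (sP x).1.
pose limit x := forall y, s y <> x.
have dec x : exists p : k * nat, limit p.1 /\ iter p.2 s p.1 = x.
  elim/cardinal_lt_ind: x => x IH.
  have [lx|/existsNP[y /contrapT yx]] := pselect (limit x).
    by exists (x, 0).
  have [|[l n] [/= ll ny]] := IH y; first by rewrite -yx (sP y).1.
  by exists (l, n.+1); rewrite /= ny.
have uniq_dec n m l l' : limit l -> limit l' -> iter n s l = iter m s l' ->
    n = m /\ l = l'.
  move=> ll ll'; elim: n m => [|n IH] [|m] //=.
  - by move=> /esym/ll.
  - by move=> /ll'.
  - by move=> /sI/IH[-> ->].
have [c cP] := choice dec.
pose g (p : k * nat) := iter (pickle ((c p.1).2, p.2)) s (c p.1).1.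
apply: (@inj_card_leT _ _ _ g) => //.
move=> [x n] [y m] /=.
move=> /(uniq_dec _ _ _ _ (cP _).1 (cP _).1)[].
move=> /(pcan_inj (@pickleK _))[cxy2 ->] cxy.
congr pair.
by rewrite -(cP x).2 -(cP y).2 cxy cxy2.
Qed.

Lemma bigcup_card_le (k : cardinal) (T : Type) (F : nat -> set T) :
  infinite_set [set: k] -> (forall n, F n #<= [set: k]) ->
  \bigcup_n F n #<= [set: k].
Proof.
move=> kinf Fk; apply: card_le_trans (card_le_mul_nat kinf).
have e n : exists f : F n -> k, injective f.
  have : [set: F n] #<= [set: k] by rewrite card_le_set_typeP.
  by move=> /card_leT_inj[f fI _]; exists f.
pose f n := projT1 (cid (e n)).
have fI n : injective (f n) := projT2 (cid (e n)).
rewrite -card_le_set_typeP.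
have g (x : \bigcup_n F n) : {n & F n (val x)}.
  by apply: cid; have [n _ ?] := set_mem (valP x); exists n.
pose r n x (Fx : F n x) : F n := exist _ x (mem_set Fx).
pose h x := (f _ (r _ _ (projT2 (g x))), projT1 (g x)).
apply: (@inj_card_leT _ _ _ h) => // x y; rewrite /h.
case: (g x) (g y) => n Fx [m Fy] /= [+ nm]; subst m.
by move=> /fI/(congr1 val)/= xy; exact: val_inj.
Qed.

(** Otherwise countably many initial segments, each of size at most [k], would exhaust the successor
    of [k]. *)
Lemma succ_cardinal_countable_bounded (k : cardinal)
    (A : set (succ_cardinal k)) :
  infinite_set [set: k] -> countable A -> exists x, forall y, A y -> y < x.
Proof.
move=> kinf /card_leP Ac; apply: contrapT => /forallNP nA.
have [e eI] : exists e : A -> nat, injective e.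
  have : [set: A] #<= [set: nat] by rewrite card_le_set_typeP; apply/card_leP.
  by move=> /card_leT_inj[f fI _]; exists f.
have [[_ nlk] _] := succ_cardinalP k; apply: nlk; rewrite /cardinal_le.
pose F n := [set x | exists2 a : A, e a = n & x <= val a].
apply: (@card_le_trans _ _ _ (\bigcup_n F n)).
  apply: subset_card_le => x _.
  have /existsNP[y /not_implyP[Ay /negP]] := nA x; rewrite -leNgt => xy.
  by exists (e (SigSub (mem_set Ay))) => //; exists (SigSub (mem_set Ay)).
apply: bigcup_card_le => // n.
have [[a ea]|na] := pselect (exists a : A, e a = n); last first.
  have -> : F n = set0 by rewrite -subset0 => x [a ea _]; apply: na; exists a.
  exact: card_ge0.
have linf : infinite_set [set: succ_cardinal k].
  by move=> lfin; apply/kinf/card_le_finite/lfin/cardinal_le_succ.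
have [b ab] := infinite_cardinal_no_max linf (val a).
apply: card_le_trans (succ_cardinal_initial b).
apply: subset_card_le => x [a' ea' xa] /=; apply: le_lt_trans ab.
by rewrite -(eI a' a)// ea' ea.
Qed.

(** * Regular cardinals and the Tukey order *)

Lemma infinite_aleph (n : nat) : infinite_set [set: aleph n].
Proof.
elim: n => [|n IH] /=; first exact: infinite_nat.
by move=> lfin; apply/IH/card_le_finite/lfin/cardinal_le_succ.
Qed.

Lemma countable_or_aleph1_le (T : Type) (S : set T) :
  countable S \/ [set: aleph 1] #<= S.
Proof. exact: (card_le_succ_cardinal aleph0 S). Qed.

Lemma aleph1_uncountable : ~ countable [set: aleph 1].
Proof. by have [[_ +] _] := succ_cardinalP aleph0. Qed.

Lemma not_cofinal_bounded d (T : orderType d) (A : set T) :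
  ~ cofinal A -> exists x, forall y, A y -> y < x.
Proof.
move=> /existsNP[x nx]; exists x => y Ay; rewrite ltNge; apply/negP => xy.
by apply: nx; exists y.
Qed.

(** If every [D i] were bounded, their bounds would form a cofinal set of size at most that of [J],
    against regularity. Sorting a cofinal [E] instead of all of [theta] lets the lemma be applied
    again to its own output. *)
Lemma regular_pigeonhole (theta : cardinal) (I : Type) (J : set I)
    (D : I -> set theta) (E : set theta) :
  regular theta -> ~ ([set: theta] #<= J) -> cofinal E ->
  (forall x, E x -> exists2 i, J i & D i x) ->
  exists2 i, J i & cofinal (D i).
Proof.
move=> [inf reg] nJ Ecof ED; apply: contrapT => nD; apply: nJ.
have [x0 _] := infinite_setN0 inf.
have /choice[b bP] (i : I) : exists b : theta, J i -> forall y, D i y -> y < b.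
  have [Ji|nJi] := pselect (J i); last by exists x0.
  have /not_cofinal_bounded[b bD] : ~ cofinal (D i).
    by move=> ?; apply: nD; exists i.
  by exists b.
apply: card_le_trans (card_image_le b J); apply: reg => x.
have [y Ey xy] := Ecof x; have [i Ji Diy] := ED _ Ey.
by exists (b i); [exists i|exact: le_trans xy (ltW (bP _ Ji _ Diy))].
Qed.

Lemma regular_countable_bounded (theta : cardinal) (A : set theta) :
  regular theta -> cardinal_le (aleph 1) theta -> countable A ->
  exists x, forall y, A y -> y < x.
Proof.
move=> [_ reg] le1 Ac; apply: not_cofinal_bounded => /reg leA.
apply: aleph1_uncountable; apply: sub_countable Ac.
exact: card_le_trans le1 leA.
Qed.

(** A countable cofinal set would make [theta] a countable union of countable initial segments. *)
Lemma regular_eq_aleph1 (theta : cardinal) :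
  cardinal_eq theta (aleph 1) -> regular theta.
Proof.
move=> th1.
have thinf : infinite_set [set: theta].
  move=> thfin; apply: (@infinite_aleph 1); apply: card_le_finite thfin.
  by rewrite (card_le_eqr th1).
split=> // A Acof; rewrite (card_le_eql th1).
have [Ac|//] := countable_or_aleph1_le A; exfalso.
apply: aleph1_uncountable; rewrite /countable -(card_le_eql th1).
have inic (x : theta) : countable [set y | y < x].
  have [//|h] := countable_or_aleph1_le [set y | y < x].
  by exfalso; apply: (@card_initial _ x); rewrite (card_le_eql th1).
suff -> : [set: theta] = \bigcup_(a in A) [set y | y <= a].
  apply: bigcup_countable => // a _.
  have [b ab] := infinite_cardinal_no_max thinf a.
  apply: sub_countable (inic b); apply: subset_card_le => y /= ya.
  exact: le_lt_trans ab.
by apply/seteqP; split=> // x _; have [a Aa xa] := Acof x; exists a.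
Qed.

(** A cofinal subset of [P] has an element above [psi q], and [phi] takes it above [q]. *)
Lemma tukey_ge_intro d d' (P : directedType d) (Q : porderType d')
    (phi : P -> Q) (psi : Q -> P) :
  (forall q p, psi q <= p -> q <= phi p) -> tukey_ge P Q.
Proof.
move=> h; exists phi => A Acof q; have [p Ap qp] := Acof (psi q).
by exists (phi p); [exists p|exact: h].
Qed.

(** If no value for [psi q] existed, the [p] with [phi p] not above [q] would be cofinal, while
    their image misses everything above [q]. *)
Lemma tukey_ge_elim d d' (P : directedType d) (Q : porderType d') :
  tukey_ge P Q -> exists (phi : P -> Q) (psi : Q -> P),
    forall q p, psi q <= p -> q <= phi p.
Proof.
move=> [phi phiP]; exists phi.
suff /choice[psi psiP] q : exists p, forall p', p <= p' -> q <= phi p'.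
  by exists psi => q p; exact: psiP.
apply: contrapT => /forallNP nq.
have [p|_ [p np <-]//] := phiP [set p | ~ (q <= phi p)] _ q.
by have /existsNP[p' /not_implyP[pp' ?]] := nq p; exists p'.
Qed.

Lemma tukey_ge_trans d d' d'' (P : directedType d) (Q : directedType d')
    (S : porderType d'') : tukey_ge P Q -> tukey_ge Q S -> tukey_ge P S.
Proof.
move=> [f fP] [g gP]; exists (g \o f) => A Acof.
by rewrite -image_comp; exact: gP (fP _ Acof).
Qed.

(** Given [b], take [c] in [D] above [b] and [q] with [psi c <= h q]. Every [q'] above [q] then
    satisfies [b <= c <= phi (h q')]. *)
Lemma tukey_ge_cofinal d d' (P : directedType d) (Q : directedType d')
    (theta : cardinal) (phi : P -> theta) (psi : theta -> P)
    (D : set theta) (h : Q -> P) :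
  (forall b p, psi b <= p -> b <= phi p) -> cofinal D ->
  {homo h : x y / x <= y} -> (forall b, D b -> exists q, psi b <= h q) ->
  tukey_ge Q theta.
Proof.
move=> phiP Dcof hmono hD.
have /choice[g gP] b : exists q, forall q', q <= q' -> b <= phi (h q').
  have [c Dc bc] := Dcof b; have [q cq] := hD _ Dc.
  exists q => q' qq'; apply: (le_trans bc); apply: phiP.
  by apply: (le_trans cq); exact: hmono.
by apply: (@tukey_ge_intro _ _ _ _ (phi \o h) g) => b q; exact: gP.
Qed.

Lemma tukey_ge_natfun_countable (theta : cardinal) :
  infinite_set [set: theta] -> countable [set: theta] ->
  tukey_ge (nat -> nat) theta.
Proof.
move=> inf cth; have [f fI _] := card_leT_inj cth.
have [x0 _] := infinite_setN0 inf.
have /choice[b bP] n : exists b, forall x, (f x <= n)%N -> x <= b.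
  elim: n => [|n [b bP]].
    have [[x fx]|nx] := pselect (exists x, f x = 0); last first.
      by exists x0 => x; rewrite leqn0 => /eqP fx; exfalso; apply: nx; exists x.
    by exists x => y; rewrite leqn0 => /eqP fy; rewrite (fI y x)// fx fy.
  have [[x fx]|nx] := pselect (exists x, f x = n.+1); last first.
    exists b => x; rewrite leq_eqVlt => /predU1P[fx|]; last exact: bP.
    by exfalso; apply: nx; exists x.
  exists (Order.max b x) => y; rewrite leq_eqVlt => /predU1P[fy|/bP yb].
    by rewrite (fI y x) ?le_max ?lexx ?orbT// fx fy.
  by rewrite le_max yb.
(* Evaluation at [0] reduces [omega^omega] to [omega], and [b n] bounds the finitely many [x] with
   code at most [n]. *)
apply: (@tukey_ge_intro _ _ _ _ (fun u => b (u 0)) (fun x _ => f x)).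
by move=> x u /asboolP/(_ 0); exact: bP.
Qed.

(** This settles the countable [theta], so that the spectra need only be compared from [omega_1]
    on. *)
Lemma regular_below_aleph1 (theta : cardinal) :
  regular theta -> ~ cardinal_le (aleph 1) theta -> spec (nat -> nat) theta.
Proof.
move=> reg; have [cth _|//] := countable_or_aleph1_le [set: theta].
by split=> //; apply: tukey_ge_natfun_countable => //; case: reg.
Qed.

(** * Ranks of compact subsets of countable sets *)

Definition compact_set (X : topologicalType) (K : set X) (Kc : compact K) :
    compact_sets X :=
  exist (fun A : set X => `[< compact A >]) K (asboolT Kc).

(** A proper filter on the fan that does not cluster at [p] has a member missing a neighbourhood of
    [p]. It therefore lives on the finitely many [K n] not inside that neighbourhood, and their
    union is compact. *)
Lemma compact_fan (X : topologicalType) (p : X) (K : nat -> set X) :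
  (forall n, compact (K n)) ->
  (forall U, nbhs p U -> exists N, forall n, (N <= n)%N -> K n `<=` U) ->
  compact (p |` \bigcup_n K n).
Proof.
move=> Kc Kp F FF FS.
have [clp|] := pselect (cluster F p); first by exists p; split=> //; left.
move=> /existsNP[A /existsNP[U /not_implyP[FA /not_implyP[pU AU]]]].
have [N NU] := Kp U pU.
have cN : compact (\big[setU/set0]_(i < N) K i).
  by apply: bigsetU_compact => i _; exact: Kc.
have [|x [xN xF]] := cN F FF.
  apply: filterS (filterI FA FS) => x [Ax].
  move=> [xp|[n _ Knx]].
    exfalso; apply: AU; exists x; split=> //.
    by rewrite xp; exact: nbhs_singleton.
  rewrite -bigcup_mkord; exists n => //=; rewrite ltnNge; apply/negP => Nn.
  by apply: AU; exists x; split=> //; exact: NU Knx.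
exists x; split=> //; right; move: xN.
by rewrite -bigcup_mkord => -[n _ ?]; exists n.
Qed.

(** If no [U n] covered [K], the sets [K] minus [U n] would generate a proper filter, and a cluster
    point of it in [K] would lie in no [U n]. *)
Lemma compact_nondecreasing_cover (X : topologicalType) (K : set X)
    (U : nat -> set X) :
  compact K -> (forall n, open (U n)) ->
  {homo U : m n / (m <= n)%N >-> m `<=` n} ->
  K `<=` \bigcup_n U n -> exists n, K `<=` U n.
Proof.
move=> Kc Uo Umono KU; apply: contrapT => /forallNP nK.
pose F := filter_from [set: nat] (fun n => K `\` U n).
have FF : ProperFilter F.
  apply: filter_from_proper; last first.
    by move=> n _; have /nonsubset := nK n.
  apply: filter_from_filter; first by exists 0%N.
  move=> m n _ _; exists (maxn m n) => // x [Kx nU].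
  split; split=> // /Umono h; apply: nU; apply: h.
    exact: leq_maxl.
  exact: leq_maxr.
have [|x [Kx clx]] := Kc F FF; first by exists 0%N => // x [].
have [n _ Unx] := KU x Kx.
have [||y [[_ nUy] /nUy//]] := clx (K `\` U n) (U n); first by exists n.
by apply: open_nbhs_nbhs; split=> //; exact: Uo.
Qed.

Lemma compact_nested_nonempty (X : topologicalType) (K : set X)
    (F : nat -> set X) :
  compact K -> (forall n, closed (F n)) ->
  (forall n, (K `&` \bigcap_(i < n) F i) !=set0) ->
  exists2 x, K x & forall n, F n x.
Proof.
move=> Kc Fc KF; apply: contrapT => nx.
have [|m n mn x /=|x Kx|n KU] := @compact_nondecreasing_cover _ K
    (fun n => ~` \bigcap_(i < n) F i) Kc.
- by move=> n; apply: closed_openC; apply: closed_bigI => i _; exact: Fc.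
- apply: contra_not => nF i /= im; apply: nF; exact: leq_trans mn.
- apply: contrapT => nU; apply: nx; exists x => // n.
  apply: contrapT => nF; apply: nU; exists n.+1 => // nFx.
  exact/nF/nFx/ltnSn.
by have [x [Kx /(KU x Kx)]] := KF n.
Qed.

(** Countable subsets of an uncountable regular [theta] are bounded, so [phi p] can be a bound of
    all [t] with [psi t <= p]. *)
Lemma tukey_ge_countable_fibers d (P : directedType d) (theta : cardinal)
    (psi : theta -> P) :
  regular theta -> cardinal_le (aleph 1) theta ->
  (forall p, countable [set t | psi t <= p]) -> tukey_ge P theta.
Proof.
move=> reg le1 psic.
have /choice[phi phiP] p : exists x, forall t, psi t <= p -> t < x.
  by have [x xP] := regular_countable_bounded reg le1 (psic p); exists x.
by apply: (@tukey_ge_intro _ _ _ _ phi psi) => t p /phiP/ltW.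
Qed.

(** Once the values of [h] are compact, this gives the monotone map from [omega^omega] that
    [tukey_ge_cofinal] asks for. *)
Definition natfun_cover (T : Type) (h : (nat -> nat) -> set T)
    (F : set (set T)) :=
  {homo h : f g / f <= g >-> f `<=` g} /\
  forall K, F K -> exists f, K `<=` h f.

Section rank.
(** For fixed [i], the [A i j] stand for the annuli around [q i]. *)
Variables (X : topologicalType) (q : nat -> X) (A : nat -> nat -> set X).
Hypothesis closedA : forall i j, closed (A i j).
Hypothesis centerA : forall i j, ~ A i j (q i).
Hypothesis nbhsA : forall i x, x <> q i -> exists j, nbhs x (A i j).
Hypothesis smallA : forall i U, nbhs (q i) U ->
  exists N, forall j, (N <= j)%N -> A i j `<=` U.

(* [ranked w i K]: the tree of nonempty intersections of [K] with pieces
   [A i j_0], [A i.+1 j_1], and so on is well-founded of rank at most [w]. *)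
Inductive ranked : aleph 1 -> nat -> set X -> Prop :=
  Ranked w i K :
    (forall j, K `&` A i j !=set0 ->
      exists2 v, v < w & ranked v i.+1 (K `&` A i j)) ->
    ranked w i K.

Lemma ranked_inv w i K j : ranked w i K -> K `&` A i j !=set0 ->
  exists2 v, v < w & ranked v i.+1 (K `&` A i j).
Proof. by case=> {}w {}i {}K; exact. Qed.

Lemma ranked_subset w i (K L : set X) :
  K `<=` L -> ranked w i L -> ranked w i K.
Proof.
move: i K L; elim/cardinal_lt_ind: w => w IH i K L KL wL.
apply: Ranked => j [x [Kx Ax]].
have KLA : K `&` A i j `<=` L `&` A i j by exact: setSI.
have [|v vw vL] := ranked_inv (j := j) wL; first by exists x; exact: KLA.
by exists v => //; exact: IH KLA vL.
Qed.

Lemma ranked_le v w i (K : set X) : v <= w -> ranked v i K -> ranked w i K.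
Proof.
move=> vw vK; apply: Ranked => j /(ranked_inv vK)[u uv uK].
by exists u => //; exact: lt_le_trans vw.
Qed.

Lemma aleph1_initial_countable (w : aleph 1) : countable [set v | v < w].
Proof. exact: succ_cardinal_initial. Qed.

Lemma aleph1_countable_bounded (S : set (aleph 1)) : countable S ->
  exists w, forall v, S v -> v < w.
Proof. exact: (@succ_cardinal_countable_bounded aleph0 S infinite_nat). Qed.

Lemma aleph1_initial_inj (w : aleph 1) :
  exists e : aleph 1 -> nat, {in [set v | v < w] &, injective e}.
Proof. exact/countable_injP/aleph1_initial_countable. Qed.

(** Countably many ranks have a common strict bound, so a set without rank has a piece without rank.
    Iterating yields an infinite branch, and by compactness a point of [K] on it. That point is some
    [q n], yet it lies in a piece of [A n], which avoids [q n]. *)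
Lemma compact_ranked (K : set X) :
  compact K -> K `<=` range q -> exists w, ranked w 0 K.
Proof.
move=> Kc Kq; apply: contrapT => /forallNP nK.
pose bad i (L : set X) := forall w, ~ ranked w i L.
have bad0 i L : bad i L -> L !=set0.
  have [w0 _] := infinite_setN0 (@infinite_aleph 1).
  move=> bL; apply: contrapT => L0; apply: (bL w0).
  by apply: Ranked => j [x [Lx _]]; exfalso; apply: L0; exists x.
have badS i L : exists j, bad i L -> bad i.+1 (L `&` A i j).
  apply: contrapT => /forallNP nb.
  have /choice[v vP] j : exists v, ranked v i.+1 (L `&` A i j).
    by have /not_implyP[_ /existsNP[v /contrapT]] := nb j; exists v.
  have /not_implyP[bL _] := nb 0.
  have [|w wP] := @aleph1_countable_bounded (range v).
    exact: card_le_trans (card_image_le _ _) _.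
  apply: (bL w); apply: Ranked => j _; exists (v j) => //.
  by apply: wP; exists j.
have /choice[J JP] (iL : nat * set X) : exists j, bad iL.1 iL.2 ->
    bad iL.1.+1 (iL.2 `&` A iL.1 j) by exact: badS.
(* The bad branch: [J] picks the next piece from the stage and the current set. *)
pose L := fix L n := if n is m.+1 then L m `&` A m (J (m, L m)) else K.
have badL n : bad n (L n) by elim: n => //= n IH; exact: (JP (n, L n)).
have LE n : L n = K `&` \bigcap_(i < n) A i (J (i, L i)).
  elim: n => [|n IH]; first by rewrite bigcap_mkord big_ord0 setIT.
  by rewrite [LHS]/= {1}IH !bigcap_mkord big_ord_recr /= setIA.
have [||x Kx xA] := @compact_nested_nonempty _ K (fun i => A i (J (i, L i))) Kc.
- by move=> n; exact: closedA.
- by move=> n; rewrite -LE; exact/bad0/badL.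
have [n _ qx] := Kq x Kx.
by apply: (@centerA n (J (n, L n))); rewrite qx; exact: xA.
Qed.

(** Induction on [w]. Apart from [q i], a set of rank at most [w] splits into pieces in the [A i j],
    each of some rank below [w] and covered by induction. One function codes the parameters for all
    [j], and the pieces form a fan at [q i]. *)
Lemma ranked_cover w i :
  exists2 h, natfun_cover h (ranked w i) & forall f, compact (h f).
Proof.
elim/cardinal_lt_ind: w i => w IH i.
have [e eI] := aleph1_initial_inj w.
(* [g n] is the cover for the rank [v] with code [n], or constantly empty if no rank below [w] has
   that code. *)
have /choice[g gP] n : exists h : (nat -> nat) -> set X,
    [/\ forall f, compact (h f), {homo h : f g / f <= g >-> f `<=` g} &
      forall v K, v < w -> e v = n -> ranked v i.+1 K -> exists f, K `<=` h f].
  have [[v [vw vn]]|nv] := pselect (exists v, v < w /\ e v = n).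
    have [h [hm hK] hc] := IH v vw i.+1.
    exists h; split; [exact: hc|exact: hm|].
    move=> v' K v'w v'n.
    by rewrite (_ : v' = v); [exact: hK|apply: eI; rewrite ?inE ?vn].
  exists (fun=> set0); split=> [_|f g _ x //|]; first exact: compact0.
  by move=> v K vw vn; exfalso; apply: nv; exists v.
(* The value [f 0] bounds the code of the rank instead of naming it, which keeps [H] monotone; the
   shift of [f] is the parameter passed on. *)
pose H (f : nat -> nat) := \big[setU/set0]_(m < (f 0).+1) g m (f \o S).
have HE f : H f = \bigcup_(m < (f 0).+1) g m (f \o S) by rewrite bigcup_mkord.
have Hc f : compact (H f).
  by apply: bigsetU_compact => m _; have [+ _ _] := gP m; exact.
have Hm f f' : (forall n, f n <= f' n)%N -> H f `<=` H f'.
  move=> ff'; rewrite !HE => x [m /= mf gx].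
  exists m; first by rewrite /= (leq_trans mf)// ltnS ff'.
  have [_ + _] := gP m; apply; last exact: gx.
  by apply/asboolP => n /=; exact: ff'.
(* Row [j] of [f], read as a matrix through the pairing of integers. *)
pose sec (f : nat -> nat) (j n : nat) := f (pickle (j, n)).
pose h f := q i |` \bigcup_j (H (sec f j) `&` A i j).
exists h; last first.
  move=> f; apply: compact_fan => [n|U qU]; first exact: compact_closedI.
  by have [N NU] := smallA qU; exists N => n /NU nU x [_ /nU].
split=> [f f' /asboolP ff'|K wK].
  apply: setUS; apply: subset_bigcup => j _; apply: setSI; apply: Hm => n.
  exact: ff'.
have /choice[F FP] j : exists f, K `&` A i j `<=` H f.
  have [KA|KA] := pselect (K `&` A i j !=set0); last first.
    by exists (fun=> 0) => x KAx; exfalso; apply: KA; exists x.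
  have [v vw vK] := ranked_inv wK KA.
  have [_ _ gK] := gP (e v); have [f Kf] := gK v _ vw erefl vK.
  exists (fun n => if n is m.+1 then f m else e v) => x /Kf gx.
  by rewrite HE; exists (e v) => /=.
(* The rows [F j] are assembled into one function; the default [0] falls outside the range of the
   pairing and is never read. *)
exists (fun n => if unpickle n is Some p then F p.1 p.2 else 0) => x Kx.
have [->|/eqP/nbhsA[j /nbhs_singleton Ax]] := eqVneq x (q i); first by left.
right; exists j => //; split=> //.
rewrite (_ : sec _ j = F j); first exact: FP.
by apply/funext => n; rewrite /sec pickleK.
Qed.

(** Induction on [w]. Choose [p] in [U] other than [q i], interior to some [A i j]. For each of the
    countably many [v < w] put a compact set not of rank at most [v] near [p], inside [U] and
    [A i j], so that these sets converge to [p]. Their fan has a piece in [A i j] exceeding every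
    [v < w]. *)
Lemma compact_not_ranked w i (U : set X) :
  (forall p : X, exists V : nat -> set X,
     (forall n, nbhs p (V n)) /\
     forall O, nbhs p O -> exists N, forall n, (N <= n)%N -> V n `<=` O) ->
  (forall x (O : set X), open O -> O !=set0 -> exists2 y, O y & y <> x) ->
  open U -> U !=set0 ->
  exists K, [/\ compact K, K `<=` U & ~ ranked w i K].
Proof.
move=> base noniso; elim/cardinal_lt_ind: w i U => w IH i U oU U0.
have [p Up /nbhsA[j pA]] := noniso (q i) U oU U0.
have [V [pV VO]] := base p.
have [e eI] := aleph1_initial_inj w.
have /choice[K KP] n : exists K, [/\ compact K, K `<=` V n, K `<=` U `&` A i j &
    forall v, v < w -> e v = n -> ~ ranked v i.+1 K].
  have [[v [vw vn]]|nv] := pselect (exists v, v < w /\ e v = n); last first.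
    exists set0; split=> //; first exact: compact0.
    by move=> v vw vn; exfalso; apply: nv; exists v.
  pose O := (V n `&` (U `&` A i j))^°.
  have [||K [Kc KO nK]] := IH v vw i.+1 O; first exact: open_interior.
    exists p; apply: filterI; first exact: pV.
    by apply: filterI => //; exact: open_nbhs_nbhs.
  have {}KO x : K x -> (V n `&` (U `&` A i j)) x.
    by move=> /KO/interior_subset.
  exists K; split=> // [x /KO[]//|x /KO[_]//|v' v'w v'n].
  by rewrite (_ : v' = v)//; apply: eI; rewrite ?inE ?vn.
have pA' := nbhs_singleton pA.
exists (p |` \bigcup_n K n); split.
- apply: compact_fan => [n|O pO]; first by have [] := KP n.
  have [N NO] := VO O pO; exists N => n Nn x Kx; apply: (NO n Nn).
  by have [_ + _ _] := KP n; exact.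
- by move=> x [->//|[n _ Kx]]; have [_ _ + _] := KP n => /(_ x Kx)[].
(* The vertex [p] keeps this piece nonempty even when [w] is least. *)
- move=> /(@ranked_inv _ _ _ j)[|v vw]; first by exists p; split=> //; left.
  have [_ _ KA nK] := KP (e v); apply: contra_not (nK v vw erefl).
  apply: ranked_subset => x Kx; split; last by have [] := KA x Kx.
  by right; exists (e v).
Qed.

(** Send [t] to a compact set not of rank at most [b t]. A compact [K] has some rank bound [w], so
    it contains the images only of those [t] with [b t < w], which are countably many. *)
Lemma tukey_ge_compact_sets_aleph1 (theta : cardinal) :
  (forall p : X, exists V : nat -> set X,
     (forall n, nbhs p (V n)) /\
     forall O, nbhs p O -> exists N, forall n, (N <= n)%N -> V n `<=` O) ->
  (forall x (O : set X), open O -> O !=set0 -> exists2 y, O y & y <> x) ->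
  range q = [set: X] ->
  cardinal_eq theta (aleph 1) -> tukey_ge (compact_sets X) theta.
Proof.
move=> base noniso qT th1; have reg := regular_eq_aleph1 th1.
have [b bI _] : exists2 b : theta -> aleph 1,
    injective b & forall x, [set: aleph 1] (b x).
  by apply: card_leT_inj; rewrite (card_le_eql th1).
have /choice[psi psiP] w : exists K : compact_sets X, ~ ranked w 0 (val K).
  have [||K [Kc _ nK]] := @compact_not_ranked w 0 setT base noniso.
  - exact: openT.
  - by exists (q 0).
  - by exists (compact_set Kc).
apply: (@tukey_ge_countable_fibers _ _ _ (psi \o b)) => //.
  by rewrite /cardinal_le (card_le_eqr th1).
move=> K; have /asboolP Kc := valP K.
have [|w wK] := @compact_ranked (val K) Kc; first by rewrite qT.
apply: sub_countable (aleph1_initial_countable w).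
rewrite -(card_le_eql (inj_card_eq (in2W bI))); apply: subset_card_le.
move=> _ [t /compact_sets_leP tK <-] /=; rewrite ltNge; apply/negP => wt.
by apply: (psiP (b t)); apply: (ranked_le wt); exact: ranked_subset tK _.
Qed.

(** As [theta] exceeds [omega_1], a single rank bound [w] serves cofinally many indices, and
    [ranked_cover] applies to it. *)
Lemma tukey_ge_natfun_countable_compact (theta : cardinal)
    (phi : compact_sets X -> theta) (psi : theta -> compact_sets X) :
  regular theta -> ~ cardinal_le theta (aleph 1) ->
  (forall b K, psi b <= K -> b <= phi K) ->
  cofinal [set b | val (psi b) `<=` range q] ->
  tukey_ge (nat -> nat) theta.
Proof.
move=> reg nth1 phiP psicof.
have [|w _ Dcof] := @regular_pigeonhole theta _ [set: aleph 1]
  (fun w => [set b | ranked w 0 (val (psi b))]) _ reg nth1 psicof.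
  move=> b /compact_ranked-/(_ (asboolW (valP (psi b))))[w wb].
  by exists w.
have [h [hm hK] hc] := ranked_cover w 0.
pose H f := compact_set (hc f).
apply: (tukey_ge_cofinal (h := H) phiP Dcof) => [f g fg|b /hK[f bf]].
  by apply/compact_sets_leP; exact: hm.
by exists f; apply/compact_sets_leP.
Qed.

End rank.

Local Open Scope ring_scope.
Local Open Scope classical_set_scope.

(** * Separable metrizable spaces *)

(** The distance is a function on [X] itself, so metrizable spaces and the rationals are treated
    alike without changing the carrier. *)
Definition metric_for (R : realType) (X : topologicalType) (d : X -> X -> R) :=
  [/\ forall x y, d x y = 0 <-> x = y,
      forall x y, d x y = d y x,
      forall x y z, d x z <= d x y + d y z &
      forall x (U : set X),
        nbhs x U <-> exists2 e, 0 < e & [set y | d x y < e] `<=` U].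

Lemma metrizable_metric_for (R : realType) (X : topologicalType) :
  metrizable R X -> exists d : X -> X -> R, metric_for d.
Proof.
move=> [M [f [g [fc gc fK gK]]]]; exists (fun x y => mdist (f x) (f y)); split.
- move=> x y; split=> [/mdist_positivity/(can_inj fK)//|->]; exact: mdistxx.
- by move=> x y; exact: metric_sym.
- by move=> x y z; exact: metric_triangle.
move=> x U; split=> [xU|[e e0 eU]].
  have : nbhs (f x) (g @^-1` U) by have := gc (f x) U; rewrite fK; exact.
  rewrite -nbhs_ballE => -[e /= e0 eU]; exists e => // y /= xy.
  by have := eU (f y); rewrite ballEmdist/= fK; exact.
have : nbhs (f x) (ball (f x) e) by exact: nbhsx_ballx.
move=> /(fc x); apply: (@filterS _ (nbhs x) _ (f @^-1` _)) => y /=.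
by rewrite ballEmdist; exact: eU.
Qed.

Lemma rationals_metric_for (R : realType) :
  metric_for (fun x y : rationals R => `|(ratr x : R) - ratr y|).
Proof.
split.
- move=> x y; split=> [/eqP|->]; last by rewrite subrr normr0.
  by rewrite normr_eq0 subr_eq0 => /eqP/fmorph_inj.
- by move=> x y; rewrite distrC.
- by move=> x y z; rewrite (le_trans _ (ler_normD _ _))// addrA subrK.
move=> x U; split.
  move=> [_ [[B Bop <-] Bx BU]].
  have : nbhs (ratr x : R) B by exact: open_nbhs_nbhs.
  rewrite -nbhs_ballE => -[e /= e0 eB]; exists e => // y /= xy.
  exact/BU/eB.
move=> [e e0 eU].
have : nbhs (ratr x : R) (ball (ratr x : R) e) by exact: nbhsx_ballx.
move=> /(@initial_continuous _ _ (ratr : rat -> R) x).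
by apply: (@filterS _ (nbhs x) _ (ratr @^-1` _)) => y /=; exact: eU.
Qed.

Section metric.
Variables (R : realType) (X : topologicalType) (d : X -> X -> R).
Hypothesis dM : metric_for d.
Implicit Types (x y z p q : X).

Let dxx x : d x x = 0. Proof. by have [/(_ x x)[_ ->]] := dM. Qed.
Let dsym x y : d x y = d y x. Proof. by case: dM. Qed.
Let dtri x y z : d x z <= d x y + d y z. Proof. by case: dM. Qed.

Let d_ge0 x y : 0 <= d x y.
Proof. by have := dtri x y x; rewrite dxx (dsym y x) -mulr2n pmulrn_lge0. Qed.

Lemma metric_for_gt0 x y : x <> y -> 0 < d x y.
Proof.
move=> xy; rewrite lt_neqAle d_ge0 andbT eq_sym; apply/eqP.
by have [/(_ x y)[h _] _ _ _] := dM; move=> /h.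
Qed.

Lemma metric_for_ball x (e : R) : 0 < e -> nbhs x [set y | d x y < e].
Proof. by move=> e0; have [_ _ _ h] := dM; apply/h; exists e. Qed.

Lemma metric_for_continuous x : continuous (d x).
Proof.
move=> y; apply/cvgrPdist_lt => e e0.
apply: filterS (metric_for_ball y e0) => z /= yz.
have := dtri x y z; have := dtri x z y; rewrite (dsym z y) => h1 h2.
by rewrite ltr_norml; lra.
Qed.

Lemma metric_for_hausdorff : hausdorff_space X.
Proof.
move=> x y xy; apply: contrapT => /metric_for_gt0 d0.
have d20 : 0 < d x y / 2 by lra.
have [z [/= xz yz]] := xy _ _ (metric_for_ball x d20) (metric_for_ball y d20).
by have := dtri x z y; rewrite (dsym z y); lra.
Qed.

Lemma closed_metric_ball x (e : R) : closed [set y | d x y <= e].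
Proof.
have -> : [set y | d x y <= e] = d x @^-1` [set r | r <= e] by [].
by apply: closed_comp => [y _|]; [exact: metric_for_continuous|
  exact: closed_le].
Qed.

(* The points whose inverse distance to [q] is within [1] of [n]. *)
Definition annulus q n : set X :=
  [set x | (n%:R - 1) * d q x <= 1 /\ 1 <= (n%:R + 1) * d q x].

Lemma closed_annulus q n : closed (annulus q n).
Proof.
have -> : annulus q n =
    (fun x => (n%:R - 1) * d q x) @^-1` [set r | r <= 1] `&`
    (fun x => (n%:R + 1) * d q x) @^-1` [set r | r >= 1] by [].
apply: closedI; apply: closed_comp; do ?[exact: closed_le|exact: closed_ge];
  by move=> x _; apply: cvgM; [exact: cvg_cst|exact: metric_for_continuous].
Qed.

Lemma annulus_center q n : ~ annulus q n q.
Proof. by rewrite /annulus/= !dxx !mulr0 => -[_]; rewrite ler10. Qed.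

Lemma nbhs_annulus q x : x <> q -> exists n, nbhs x (annulus q n).
Proof.
move=> /nesym/metric_for_gt0 d0.
(* The inverse distance lies in [[n, n + 1)], hence strictly between [n - 1] and [n + 1]; strictness
   persists near [x]. *)
pose n := Num.truncn (d q x)^-1; exists n.
have /andP[n1 n2] : n%:R <= (d q x)^-1 < n.+1%:R.
  by rewrite truncn_itv// invr_ge0 ltW.
have h1 : (n%:R - 1) * d q x < 1.
  by rewrite -ltr_pdivlMr// mul1r; lra.
have h2 : 1 < (n%:R + 1) * d q x.
  by rewrite -ltr_pdivrMr// mul1r; rewrite -natr1 in n2.
have c (a : R) : (fun y => a * d q y) @ x --> a * d q x.
  by apply: cvgM; [exact: cvg_cst|exact: metric_for_continuous].
have : \forall y \near x, (n%:R - 1) * d q y < 1 by exact: c _ _ (lt_nbhsl h1).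
have : \forall y \near x, 1 < (n%:R + 1) * d q y by exact: c _ _ (lt_nbhsr h2).
apply: (@filterS2 _ (nbhs x)) => y /= h4 h3.
by split; exact: ltW.
Qed.

Lemma annulus_small q U : nbhs q U ->
  exists N, forall n, (N <= n)%N -> annulus q n `<=` U.
Proof.
have [_ _ _ h] := dM; move=> /h[e e0 eU].
(* Two more than the integer part ensures [n - 1 > 1 / e]. *)
exists (Num.truncn e^-1).+2 => n Nn x [hx _]; apply: eU => /=.
have en : e^-1 < n%:R - 1.
  have : e^-1 < (Num.truncn e^-1).+1%:R by exact: truncnS_gt.
  have : (Num.truncn e^-1).+2%:R <= n%:R :> R by rewrite ler_nat.
  by rewrite -(natr1 _.+1); lra.
have i0 : 0 < e^-1 by rewrite invr_gt0.
rewrite ltNge; apply/negP => ed.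
have : 1 < (n%:R - 1) * d q x; last by lra.
apply: (@lt_le_trans _ _ ((n%:R - 1) * e)).
  by rewrite -ltr_pdivrMr// mul1r.
by rewrite ler_wpM2l//; lra.
Qed.

End metric.

(** * Total imperfectness and copies of the Cantor space *)

(** A continuous injection of a compact space into a Hausdorff one is closed, hence a homeomorphism
    onto its range. *)
Lemma totally_imperfect_no_embedding (X : topologicalType)
    (c : cantor_space -> X) :
  hausdorff_space X -> totally_imperfect X -> continuous c -> ~ injective c.
Proof.
move=> hX tiX cc cI; apply: (tiX (range c)).
pose f (s : cantor_space) : range c := exist _ (c s) (mem_set (imageT c s)).
have /choice[g gP] (a : range c) : exists s, c s = val a.
  by have [s _ sa] := set_mem (valP a); exists s.
exists f; exists g; split.
- apply: (@continuous_comp_initial _ _ _ (set_val : range c -> X) f).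
  exact: cc.
- apply/continuous_closedP => C Ccl.
  have -> : g @^-1` C = set_val @^-1` (c @` C).
    apply/seteqP; split=> [a Ca|a [s Cs sa]]; first by exists (g a).
    by rewrite /preimage/= -(_ : s = g a)//; apply: cI; rewrite sa gP.
  apply: closed_comp => [a _|]; first exact: initial_continuous.
  apply: compact_closed => //; apply: continuous_compact.
    exact: continuous_subspaceT.
  exact: subclosed_compact Ccl cantor_space_compact _.
- by move=> s; apply: cI; rewrite gP.
- by move=> a; apply: val_inj; rewrite /= gP.
Qed.

Lemma nbhs_cantor_prefix (s : cantor_space) n :
  nbhs s [set t : cantor_space | forall i, (i < n)%N -> t i = s i].
Proof.
elim: n => [|n IH]; first by apply: filterS filterT => t _ i.
have sn : nbhs s [set t : cantor_space | t n = s n].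
  apply: (@proj_continuous nat (fun=> bool) n s [set b | b = s n]).
  exact: discrete_set1.
apply: (@filterS2 _ (nbhs s)) IH sn => t h tn i.
by rewrite ltnS leq_eqVlt => /predU1P[->//|]; exact: h.
Qed.

(** * Failure of local compactness and [omega^omega] *)

Definition countable_base (X : topologicalType) (V : nat -> set X) :=
  (forall n, open (V n)) /\
  forall x O, nbhs x O -> exists2 n, V n x & V n `<=` O.

(** Take a proper filter containing [C] without cluster point in [C]. The basic sets disjoint from
    some member of it cover [C], while the complement of finitely many of them belongs to the filter
    and so meets [C]. *)
Lemma noncompact_cover (X : topologicalType) (V : nat -> set X) (C : set X) :
  countable_base V -> ~ compact C ->
  exists U : nat -> set X, [/\ forall n, open (U n),
    {homo U : m n / (m <= n)%N >-> m `<=` n}, C `<=` \bigcup_n U n &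
    forall n, ~ C `<=` U n].
Proof.
move=> [Vo Vb] /existsNP[F /not_implyP[FF /not_implyP[FC nF]]].
pose I i := exists2 W, F W & V i `&` W = set0.
exists (fun n => \bigcup_(i in [set i | (i < n)%N /\ I i]) V i); split.
- by move=> n; apply: bigcup_open => i _; exact: Vo.
- move=> m n mn; apply: bigcup_subset => i [im Ii]; split=> //.
  exact: leq_trans mn.
- move=> x Cx; apply: contrapT => nx; apply: nF; exists x; split=> // W O FW.
  move=> /Vb[i Vix VO]; apply: contrapT => WO; apply: nx.
  exists i.+1 => //; exists i => //; split=> //; exists W => //.
  rewrite -subset0 => y [Viy Wy]; apply: WO; exists y; split=> //; exact: VO.
- move=> n CU.
  suff FU : F (~` \bigcup_(i in [set i | (i < n)%N /\ I i]) V i).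
    have [x [Cx]] := filter_ex (filterI FC FU); apply; exact: CU.
  elim: {CU} n => [|n IH]; first by apply: filterS filterT => x _ [i []].
  have [[W FW VW]|nI] := pselect (I n); last first.
    apply: filterS IH => x nx [i [iS Ii] Vx]; apply: nx; exists i => //.
    split=> //.
    move: iS; rewrite ltnS leq_eqVlt => /predU1P[ni|//].
    by exfalso; apply: nI; rewrite -ni.
  apply: filterS (filterI IH FW) => x [nx Wx] [i [iS Ii] Vx].
  move: iS; rewrite ltnS leq_eqVlt => /predU1P[ni|iltn].
    by move: VW; rewrite -subset0 => /(_ x); apply; rewrite -ni.
  by apply: nx; exists i.
Qed.

Lemma tukey_ge_natfun (X : topologicalType) (V W : nat -> set X) (p : X) :
  countable_base V -> (forall n, closed (W n)) -> (forall n, nbhs p (W n)) ->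
  (forall U, nbhs p U -> exists N, forall n, (N <= n)%N -> W n `<=` U) ->
  (forall C, nbhs p C -> ~ compact C) ->
  tukey_ge (compact_sets X) (nat -> nat).
Proof.
move=> Vb Wc pW Wp pC.
have /choice[U UP] n := noncompact_cover Vb (pC _ (pW n)).
(* The points [x (n, f n)] converge to [p]. If [K] contains them all, the index at which [U n]
   covers the part of [K] in [W n] cannot be smaller than [f n]. *)
have /choice[x xP] (nm : nat * nat) : exists x, (W nm.1 `\` U nm.1 nm.2) x.
  by apply/nonsubset; have [_ _ _ +] := UP nm.1; exact.
have Kc f : compact (p |` \bigcup_n [set x (n, f n)]).
  apply: compact_fan => [n|O /Wp[N NO]]; first exact: compact_set1.
  by exists N => n /NO nO y ->; apply: nO; have [] := xP (n, f n).
have /choice[phi phiP] (K : compact_sets X) : exists g : nat -> nat, forall n,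
    val K `&` W n `<=` U n (g n).
  suff /choice[g gP] n : exists m, val K `&` W n `<=` U n m by exists g.
  have [Uo Um WU _] := UP n.
  apply: (compact_nondecreasing_cover _ Uo Um) => [|y [_ /WU//]].
  by apply: compact_closedI => //; exact: (asboolW (valP K)).
pose psi f := compact_set (Kc f).
apply: (@tukey_ge_intro _ _ _ _ phi psi) => f K /compact_sets_leP fK.
apply/asboolP => n; rewrite leEnat leqNgt; apply/negP => /ltnW Kf.
have [Wx nU] := xP (n, f n); apply: nU.
have [_ Um _ _] := UP n; apply: (Um _ _ Kf); apply: phiP; split=> //.
by apply: fK; right; exists n.
Qed.

(** Otherwise every point has a countable neighbourhood, and countably many countable basic sets
    cover the space. *)
Lemma uncountable_not_locally_compact (X : topologicalType) (V : nat -> set X) :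
  countable_base V -> ~ countable [set: X] ->
  (forall K : set X, compact K -> countable K) ->
  exists p : X, forall C, nbhs p C -> ~ compact C.
Proof.
move=> [_ Vb] nX Kc; apply: contrapT => /forallNP nlc; apply: nX.
have -> : [set: X] = \bigcup_(n in [set n | countable (V n)]) V n.
  apply/seteqP; split=> // x _.
  have /existsNP[C /not_implyP[/Vb[n Vx VC] /contrapT/Kc cC]] := nlc x.
  exists n => //=; exact: sub_countable (subset_card_le VC) cC.
exact: bigcup_countable.
Qed.

(** * Cantor schemes in uncountable compact sets *)

(** The points of [A] that are not condensation points lie in countably many countable traces of
    basic sets. With at most one condensation point, [A] would be countable. *)
Lemma uncountable_condensation (X : topologicalType) (V : nat -> set X)
    (A : set X) :
  countable_base V -> ~ countable A ->
  exists x y : X, x <> y /\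
    forall O, nbhs x O \/ nbhs y O -> ~ countable (A `&` O).
Proof.
move=> [_ Vb] nA; apply: contrapT => nxy; apply: nA.
pose cond (x : X) := forall O, nbhs x O -> ~ countable (A `&` O).
have -> : A = (A `&` cond) `|`
    \bigcup_(n in [set n | countable (A `&` V n)]) (A `&` V n).
  apply/seteqP; split=> [x Ax|x [[]|[n _ []]]] //.
  have [cx|] := pselect (cond x); first by left.
  move=> /existsNP[U /not_implyP[/Vb[n Vx VU] /contrapT cU]].
  right; exists n => //=; apply: sub_countable cU; apply: subset_card_le.
  exact: setIS.
rewrite -bigcup2E; apply: bigcup_countable => // -[|[|n]] _ /=.
- have [[x [Ax cx]]|n0] := pselect ((A `&` cond) !=set0); last first.
    by rewrite (_ : _ `&` _ = set0)//; apply/eqP/negPn/negP => /set0P.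
  apply: (@sub_countable _ _ _ [set x]); last exact: countable1.
  apply: subset_card_le => y [Ay cy]; apply: contrapT => yx; apply: nxy.
  by exists x, y; split=> [/esym//|O [/cx|/cy]].
- exact: bigcup_countable.
- exact: countable0.
Qed.

Lemma metric_for_countable_base (R : realType) (X : topologicalType)
    (d : X -> X -> R) :
  metric_for d -> separable X -> exists V : nat -> set X, countable_base V.
Proof.
move=> dM [D /countable_injP[e eI] Dd]; have [d0 dsym dtri _] := dM.
have ballo x (r : R) : open [set y | d x y < r].
  rewrite openE => y /= xy.
  have r0 : 0 < r - d x y by rewrite subr_gt0.
  apply: filterS (metric_for_ball dM y r0) => z /= yz.
  by have := dtri x y z; lra.
pose B (m k : nat) :=
  \bigcup_(x in [set x | D x /\ e x = m]) [set y | d x y < k.+1%:R^-1].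
exists (fun n => if unpickle n is Some p then B p.1 p.2 else set0); split.
  move=> n; case: unpickle => [[m k]|]; last exact: open0.
  by apply: bigcup_open => x _; exact: ballo.
move=> x O xO; have [_ _ _ /(_ x O)[/(_ xO)[r r0 rO] _]] := dM.
pose k := Num.truncn (2 / r).
have k0 : 0 < k.+1%:R^-1 :> R by rewrite invr_gt0.
have kr : k.+1%:R^-1 < r / 2.
  by rewrite -[ltRHS]invf_div ltf_pV2 ?posrE ?divr_gt0// truncnS_gt.
have [|z [/= xz Dz]] := Dd _ _ (ballo x k.+1%:R^-1).
  by exists x => /=; rewrite (d0 x x).2.
exists (pickle (e z, k)); rewrite pickleK /B /=.
  by exists z => //=; rewrite dsym.
move=> y [z' /= [Dz' zz'] zy]; apply: rO => /=.
have zE : z' = z by apply: eI; rewrite ?inE.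
move: zy xz kr; rewrite zE => h1 h2 h3; apply: le_lt_trans (dtri x z y) _.
by rewrite (splitr r) ltrD// (lt_trans _ h3).
Qed.

Lemma uncountable_split (R : realType) (X : topologicalType) (d : X -> X -> R)
    (V : nat -> set X) (A : set X) (r : R) :
  metric_for d -> countable_base V -> closed A -> ~ countable A -> 0 < r ->
  exists S : bool -> set X, S true `&` S false = set0 /\
    forall b, [/\ closed (S b), ~ countable (S b), S b `<=` A &
      exists x, forall y, S b y -> d x y <= r].
Proof.
move=> dM Vb Acl nA r0; have [d0 dsym dtri _] := dM.
have [x [y [xy cxy]]] := uncountable_condensation Vb nA.
have dxy := metric_for_gt0 dM xy.
(* A third of the distance makes the two closed balls disjoint. *)
pose s := Num.min r (d x y / 3).
have s0 : 0 < s by rewrite lt_min r0 divr_gt0.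
have sr : s <= r by rewrite ge_min lexx.
have sd : s <= d x y / 3 by rewrite ge_min lexx orbT.
exists (fun b => A `&` [set z | d (if b then x else y) z <= s]); split.
  rewrite -subset0 => z [[_ /= xz] [_ /= yz]].
  by have := dtri x z y; rewrite (dsym z y); lra.
move=> b; split.
- by apply: closedI => //; exact: closed_metric_ball.
- apply: cxy; have h z : nbhs z [set t | d z t <= s].
    by apply: filterS (metric_for_ball dM z s0) => t /ltW.
  by case: b; [left|right]; exact: h.
- by move=> z [].
- by exists (if b then x else y) => z [_ /= /le_trans]; apply.
Qed.

(** Repeated splitting with radii tending to [0] gives a Cantor scheme: [L s n] depends on the first
    [n] bits of [s], and [c s] is a point common to all [L s n]. Sequences that first differ at [m]
    fall into disjoint halves at stage [m.+1]. *)
Lemma uncountable_compact_cantor (R : realType) (X : topologicalType)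
    (d : X -> X -> R) (V : nat -> set X) (K : set X) :
  metric_for d -> countable_base V -> compact K -> ~ countable K ->
  exists c : cantor_space -> X, continuous c /\ injective c.
Proof.
move=> dM Vb Kc nK; have [d0 dsym dtri dnbhs] := dM.
pose good (A : set X) := closed A /\ ~ countable A.
have /choice[S SP] (nA : nat * set X) : exists S : bool -> set X,
    good nA.2 -> S true `&` S false = set0 /\
    forall b, [/\ closed (S b), ~ countable (S b), S b `<=` nA.2 &
      exists x, forall y, S b y -> d x y <= nA.1.+1%:R^-1].
  have [[Acl nA']|nA'] := pselect (good nA.2); last first.
    by exists (fun=> set0) => /nA'.
  have r0 : 0 < nA.1.+1%:R^-1 :> R by rewrite invr_gt0.
  by have [S ?] := uncountable_split dM Vb Acl nA' r0; exists S.
pose L := fix L (s : nat -> bool) n :=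
  if n is m.+1 then S (m, L s m) (s m) else K.
have goodL s n : good (L s n).
  elim: n => [|n IH] /=.
    by split=> //; exact: compact_closed (metric_for_hausdorff dM) Kc.
  by have [_ /(_ (s n))[]] := SP (n, L s n) IH.
have LS s n : L s n.+1 `<=` L s n.
  by have [_ /(_ (s n))[]] := SP (n, L s n) (goodL s n).
have Ldec s m n : (m <= n)%N -> L s n `<=` L s m.
  elim: n => [|n IH]; first by rewrite leqn0 => /eqP ->.
  rewrite leq_eqVlt => /predU1P[->//|/IH]; exact: subset_trans.
have Leq (s t : nat -> bool) n :
    (forall i, (i < n)%N -> t i = s i) -> L t n = L s n.
  elim: n => //= n IH h; rewrite h ?ltnSn// IH// => i ni.
  by apply: h; exact: ltnW.
have /choice[c cP] (s : cantor_space) : exists x, forall n, L s n x.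
  have [||x _ xL] := @compact_nested_nonempty _ K (L s) Kc; last by exists x.
    by move=> n; have [] := goodL s n.
  move=> n; have [x Lx] : L s n !=set0.
    apply/set0P/negP => /eqP L0; have [_ +] := goodL s n; apply.
    by rewrite L0; exact: countable0.
  exists x; split; first exact: (Ldec s 0 n _ x Lx).
  by move=> i /= /ltnW ni; exact: (Ldec s i n ni x Lx).
exists c; split.
  move=> s U /dnbhs[r r0 rU].
  (* Points of [L s n.+1] lie within [1 / (n + 1) < r / 2] of a common centre, hence within [r] of
     each other. *)
  pose n := Num.truncn (2 / r).
  have nr : n.+1%:R^-1 < r / 2.
    by rewrite -[ltRHS]invf_div ltf_pV2 ?posrE ?divr_gt0// truncnS_gt.
  apply: filterS (nbhs_cantor_prefix s n.+1) => t /(Leq s t n.+1) ts.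
  apply: rU => /=.
  have [_ /(_ (s n))[_ _ _ [x xP]]] := SP (n, L s n) (goodL s n).
  have := xP _ (cP s n.+1); have := cP t n.+1; rewrite ts => /xP /= h1 h2.
  apply: le_lt_trans (dtri (c s) x (c t)) _.
  by rewrite (dsym _ x) (splitr r) ltrD// (le_lt_trans _ nr).
move=> s t cst; apply: contrapT => st.
have [n sn] : exists n, s n <> t n.
  apply: contrapT => /forallNP h; apply: st; apply/funext => n.
  by apply: contrapT; exact: h.
have ex : exists n, s n != t n by exists n; exact/eqP.
case: (ex_minnP ex) => m sm mmin.
have ts : L t m = L s m.
  apply: Leq => i im; apply/esym/eqP; apply: contraTT im => /mmin.
  by rewrite -leqNgt.
have [+ _] := SP (m, L s m) (goodL s m); rewrite -subset0 => /(_ (c s)); apply.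
have := cP s m.+1; have := cP t m.+1; rewrite /= ts -cst.
by case: (s m) (t m) sm => [] [].
Qed.

Lemma totally_imperfect_countable (R : realType) (X : topologicalType)
    (d : X -> X -> R) (V : nat -> set X) (K : set X) :
  metric_for d -> countable_base V -> totally_imperfect X ->
  compact K -> countable K.
Proof.
move=> dM Vb tiX Kc; apply: contrapT => nK.
have [c [cc cI]] := uncountable_compact_cantor dM Vb Kc nK.
exact: (totally_imperfect_no_embedding (metric_for_hausdorff dM) tiX cc cI).
Qed.

(** * Countable supports and Tukey reductions for metric spaces *)

Lemma countable_sub_range (T : Type) (x0 : T) (S : set T) :
  countable S -> exists q : nat -> T, S `<=` range q.
Proof.
move=> /countable_injP[e eI].
have /choice[q qP] n : exists x, forall y, S y -> e y = n -> y = x.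
  have [[x [Sx xn]]|nx] := pselect (exists x, S x /\ e x = n).
    by exists x => y Sy yn; apply: eI; rewrite ?inE ?yn.
  by exists x0 => y Sy yn; exfalso; apply: nx; exists y.
by exists q => x Sx; exists (e x) => //; rewrite -(qP _ _ Sx erefl).
Qed.

(** Descent on [n]. A countable [psi b] is bounded in an enumeration of [S] by [aleph n.+1]. Since
    [theta] is larger, one bound works for cofinally many [b], and the part of [S] below it has size
    at most [aleph n]. *)
Lemma cofinal_countable_support (theta : cardinal) (n : nat) (T : Type)
    (psi : theta -> set T) (S : set T) :
  regular theta -> ~ cardinal_le theta (aleph n) ->
  (forall b, countable (psi b)) -> S #<= [set: aleph n] ->
  cofinal [set b | psi b `<=` S] ->
  exists2 S' : set T, countable S' & cofinal [set b | psi b `<=` S'].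
Proof.
move=> reg + psic; elim: n S => [|n IH] S nth Sn Scof; first by exists S.
have [f fI _] : exists2 f : S -> aleph n.+1, injective f & forall x, setT (f x).
  by apply: card_leT_inj; rewrite card_le_set_typeP.
pose Y a := [set x | exists2 y : S, val y = x & (f y < a)%O].
have [|b Sb|a _ acof] := @regular_pigeonhole theta _ [set: aleph n.+1]
  (fun a => [set b | psi b `<=` Y a]) _ reg _ Scof.
- exact: nth.
- have [|a aP] := @succ_cardinal_countable_bounded (aleph n)
      (f @` [set y : S | psi b (val y)]) (@infinite_aleph n).
    apply: sub_countable (card_image_le _ _) _.
    apply: sub_countable (psic b).
    rewrite -(card_le_eql (inj_card_eq (in2W (@val_inj _ _ S)))).
    by apply: subset_card_le => _ [y by_ <-].
  exists a => // x bx; exists (exist _ x (mem_set (Sb x bx))) => //.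
  by apply: aP; exists (exist _ x (mem_set (Sb x bx))).
apply: IH acof => [thn|].
  by apply: nth; apply: card_le_trans thn _; exact: cardinal_le_succ.
apply: card_le_trans (succ_cardinal_initial a).
have -> : Y a = val @` [set y : S | (f y < a)%O].
  by apply/seteqP; split=> x [y] h1 h2; exists y.
apply: card_le_trans (card_image_le _ _) _.
rewrite -(card_le_eql (inj_card_eq (in2W fI))).
by apply: subset_card_le => _ [y ya <-].
Qed.

Lemma tukey_ge_card_le (X : topologicalType) (theta : cardinal) :
  (forall K : set X, compact K -> countable K) ->
  regular theta -> cardinal_le (aleph 1) theta -> [set: theta] #<= [set: X] ->
  tukey_ge (compact_sets X) theta.
Proof.
move=> Kc reg le1 /card_leT_inj[b bI _].
pose psi t := compact_set (@compact_set1 _ (b t)).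
apply: (@tukey_ge_countable_fibers _ _ _ psi) => // K.
apply: (@sub_countable _ _ _ (val K)); last exact/Kc/(asboolW (valP K)).
rewrite -(card_le_eql (inj_card_eq (in2W bI))).
by apply: subset_card_le => _ [t /compact_sets_leP tK <-]; exact: tK.
Qed.

Section metric.
Variables (R : realType) (X : topologicalType) (d : X -> X -> R).
Hypothesis dM : metric_for d.

Lemma metric_for_nbhs_sequence (p : X) : exists W : nat -> set X,
  [/\ forall n, nbhs p (W n), forall n, closed (W n) &
    forall U, nbhs p U -> exists N, forall n, (N <= n)%N -> W n `<=` U].
Proof.
exists (fun n => [set y | d p y <= n.+1%:R^-1]); split=> [n|n|U].
- have n0 : 0 < n.+1%:R^-1 :> R by rewrite invr_gt0.
  by apply: filterS (metric_for_ball dM p n0) => y /ltW.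
- exact: closed_metric_ball.
have [_ _ _ h] := dM; move=> /h[r r0 rU].
exists (Num.truncn r^-1) => n rn y /= yn; apply: rU => /=.
apply: le_lt_trans yn _; rewrite -[ltRHS]invrK ltf_pV2 ?posrE ?invr_gt0//.
by rewrite (lt_le_trans (truncnS_gt _))// ler_nat.
Qed.

Lemma metric_for_tukey_ge_natfun (p : X) :
  separable X -> (forall C, nbhs p C -> ~ compact C) ->
  tukey_ge (compact_sets X) (nat -> nat).
Proof.
move=> sX pC; have [V Vb] := metric_for_countable_base dM sX.
have [W [pW Wc Wp]] := metric_for_nbhs_sequence p.
exact: tukey_ge_natfun Vb Wc pW Wp pC.
Qed.

Lemma tukey_ge_natfun_countable_support (x0 : X) (theta : cardinal)
    (phi : compact_sets X -> theta) (psi : theta -> compact_sets X)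
    (S : set X) :
  regular theta -> ~ cardinal_le theta (aleph 1) ->
  (forall b K, (psi b <= K)%O -> (b <= phi K)%O) -> countable S ->
  cofinal [set b | val (psi b) `<=` S] -> tukey_ge (nat -> nat) theta.
Proof.
move=> reg nth phiP Sc Scof; have [q Sq] := countable_sub_range x0 Sc.
apply: (@tukey_ge_natfun_countable_compact X q (fun i => annulus d (q i))
  _ _ _ _ _ phi psi) => //.
- by move=> i j; exact: closed_annulus.
- by move=> i j; exact: annulus_center.
- by move=> i x; exact: nbhs_annulus.
- by move=> i U; exact: annulus_small.
- move=> b; have [c Sc' bc] := Scof b; exists c => //.
  exact: subset_trans Sq.
Qed.

Lemma tukey_ge_compact_sets_eq_aleph1 (x0 : X) (theta : cardinal) :
  countable [set: X] ->
  (forall (x : X) (U : set X), open U -> U !=set0 -> exists2 y, U y & y <> x) ->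
  cardinal_eq theta (aleph 1) -> tukey_ge (compact_sets X) theta.
Proof.
move=> Xc noniso; have [q Xq] := countable_sub_range x0 Xc.
apply: (@tukey_ge_compact_sets_aleph1 X q (fun i => annulus d (q i))) => //.
- by move=> i j; exact: closed_annulus.
- by move=> i j; exact: annulus_center.
- by move=> i x; exact: nbhs_annulus.
- by move=> p; have [W [pW _ Wp]] := metric_for_nbhs_sequence p; exists W.
- by apply/seteqP; split.
Qed.
End metric.

(** * The rationals *)

Lemma rationals_no_isolated (R : realType) (x : rationals R)
    (U : set (rationals R)) :
  open U -> U !=set0 -> exists2 y, U y & y <> x.
Proof.
move=> Uo [p Up]; have [_ _ _ /(_ p U)[+ _]] := rationals_metric_for R.
have pU : nbhs p U by exact: open_nbhs_nbhs.
move=> /(_ pU)[r r0 rU].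
have [px|px] := eqVneq (p : rat) (x : rat); last by exists p => //; exact/eqP.
have [s /andP[s0 sr]] : exists s : rat, 0 < (ratr s : R) < r.
  by have [s] := rat_in_itvoo r0; rewrite in_itv/=; exists s.
exists ((p : rat) + s : rat).
  by apply: rU; rewrite /= rmorphD/= opprD addNKr normrN gtr0_norm.
by rewrite -px => /eqP; rewrite -subr_eq0 addrC addKr => /eqP s00; move: s0;
  rewrite s00 rmorph0 ltxx.
Qed.

(** A compact neighbourhood of [0] has a closed image in the reals, which by density of the
    rationals contains an interval. The interval would be countable, hence of measure zero. *)
Lemma rationals_not_locally_compact (R : realType) (C : set (rationals R)) :
  nbhs (0%Q : rationals R) C -> ~ compact C.
Proof.
have [_ _ _ /(_ (0%Q : rationals R) C)[+ _]] := rationals_metric_for R.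
move=> /[apply] -[r r0 rC] Cc.
pose f : rationals R -> R := ratr.
have fcl : closed (f @` C).
  apply: compact_closed; first exact: Rhausdorff.
  apply: continuous_compact Cc; apply: continuous_subspaceT.
  exact: (@initial_continuous _ _ (ratr : rat -> R)).
have sub : ball (0 : R) r `<=` f @` C.
  move=> y y0; apply: fcl => B By.
  have : nbhs y (B `&` ball 0 r).
    apply: filterI => //; apply: open_nbhs_nbhs; split=> //.
    exact: ball_open.
  rewrite nbhsE => -[U [Uo Uy] UB].
  have [t [Ut [z _ zt]]] : U `&` (ratr @` [set: rat]) !=set0.
    by apply: dense_rat => //; exists y.
  move: Ut; rewrite -zt => /UB[Bz z0].
  exists (ratr z); split=> //; exists z => //.
  by apply: rC => /=; rewrite rmorph0.
have bc : countable (ball (0 : R) r).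
  apply: sub_countable (subset_card_le sub) _.
  apply: sub_countable (card_image_le _ _) _.
  exact: (@countableP rat).
have := countable_lebesgue_measure0 bc.
rewrite lebesgue_measure_ball ?ltW// => /eqP; rewrite eqe => /eqP.
by rewrite mulr2n; lra.
Qed.

Theorem proposition26 (R : realType) :
  (forall (kappa : cardinal) (B : topologicalType),
     cardinal_le (aleph 1) kappa ->
     [set: B] #= [set: kappa] ->
     separable B -> metrizable R B -> totally_imperfect B ->
     (forall theta : cardinal,
        regular_interval (aleph 1) kappa theta \/ spec (nat -> nat) theta ->
        spec (compact_sets B) theta) /\
     ((exists n : nat, cardinal_eq kappa (aleph n)) ->
      forall theta : cardinal,
        regular_interval (aleph 1) kappa theta \/ spec (nat -> nat) theta <->
        spec (compact_sets B) theta)) /\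
  (forall theta : cardinal,
     spec (compact_sets (rationals R)) theta <->
     cardinal_eq theta (aleph 1) \/ spec (nat -> nat) theta).
Proof.
split=> [kappa B le1k Bk sB mB tiB|theta].
  have [d dM] := metrizable_metric_for mB.
  have [V Vb] := metric_for_countable_base dM sB.
  have Kc (K : set B) : compact K -> countable K.
    exact: (totally_imperfect_countable dM Vb tiB).
  have nB : ~ countable [set: B].
    move=> Bc; apply: aleph1_uncountable; apply: card_le_trans Bc.
    by rewrite (card_le_eqr Bk).
  have [p pC] := uncountable_not_locally_compact Vb nB Kc.
  have lower theta :
      regular_interval (aleph 1) kappa theta \/ spec (nat -> nat) theta ->
      spec (compact_sets B) theta.
    move=> [[reg le1 lek]|[reg wth]]; split=> //.
      by apply: tukey_ge_card_le => //; rewrite (card_le_eqr Bk).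
    exact: tukey_ge_trans (metric_for_tukey_ge_natfun dM sB pC) wth.
  split=> // -[n kn] theta; split=> [|[reg Kth]]; first exact: lower.
  have [le1|nle1] := pselect (cardinal_le (aleph 1) theta); last first.
    by right; exact: regular_below_aleph1.
  have [lek|nlek] := pselect (cardinal_le theta kappa); first by left.
  right; split=> //.
  have [phi [psi phiP]] := tukey_ge_elim Kth.
  have [|b|||S Sc Scof] := @cofinal_countable_support theta n B
    (fun b => val (psi b)) [set: B] reg.
  - by move=> thn; apply: nlek; rewrite /cardinal_le (card_le_eqr kn).
  - exact/Kc/(asboolW (valP (psi b))).
  - by rewrite (card_le_eql Bk) -(card_le_eqr kn).
  - by move=> b; exists b.
  apply: (tukey_ge_natfun_countable_support dM p reg _ phiP Sc Scof).
  (* Here [theta] exceeds [kappa], which is at least [omega_1]. *)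
  by move=> th1; apply: nlek; exact: card_le_trans th1 le1k.
have dM := rationals_metric_for R.
have Qc : countable [set: rationals R] := countableP ([set: rat]).
have sQ : separable (rationals R).
  by exists setT => // U U0 _; rewrite setIT.
split=> [[reg Kth]|[th1|[reg wth]]].
- have [le1|nle1] := pselect (cardinal_le (aleph 1) theta); last first.
    by right; exact: regular_below_aleph1.
  have [th1|nth1] := pselect (cardinal_le theta (aleph 1)).
    by left; rewrite /cardinal_eq card_eq_le; apply/andP.
  right; split=> //; have [phi [psi phiP]] := tukey_ge_elim Kth.
  pose q0 : rationals R := 0%Q.
  (* The whole space serves as the countable support. *)
  apply: (tukey_ge_natfun_countable_support dM q0 reg nth1 phiP Qc).
  by move=> b; exists b.
- split; first exact: regular_eq_aleph1.
  apply: (tukey_ge_compact_sets_eq_aleph1 dM (0%Q : rationals R)) => //.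
  exact: rationals_no_isolated.
- split=> //; apply: tukey_ge_trans wth.
  exact: (metric_for_tukey_ge_natfun dM sQ (@rationals_not_locally_compact R)).
Qed.
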